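(* Let $G$ be a distinguished group, let $A$ be a simple subgroup of $G$, and let $p,q\in G$. Then $H_{pq}=(A.p).(A.q)$ is a subgroup of $G$.
   Context: A distributive group is a nonempty set $G$ with a binary operation $(a,b)\mapsto a.b$ on $G$ such that for all $a,b\in G$ each of the equations $a.x=b$ and $y.a=b$ has exactly one solution in $G$, and for all $a,b,c\in G$, $(a.b).c=(a.c).(b.c)$ and $c.(a.b)=(c.a).(c.b)$. A subgroup of $G$ is a nonempty subset which is itself a distributive group under the restricted operation; the order is the number of elements. A distributive group is simple if it has no proper subgroup of order greater than one. For subsets $X,Y\subseteq G$ and $p\in G$: $X.Y=\{x.y: x\in X,\,y\in Y\}$, $X.p=\{x.p: x\in X\}$, $p.X=\{p.x:x\in X\}$. A finite distributive group $G$ is called distinguished if for every subgroup $B$ of $G$ and every $p\in G$, the sets $B.(B.p)$ and $(B.p).B$ are subgroups of the same order as $B$; equivalently there are $t,\tau\in G$ with $B.(B.p)=B.t$ and $(B.p).B=B.(p.B)=B.\tau$. *)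

(* Defs.v *)
From mathcomp Require Import all_boot.
Set Implicit Arguments.
Unset Strict Implicit.
Unset Printing Implicit Defensive.

(* [distributive_group op D]: D is a distributive group under the restriction
   of op.  The ambient distributive group G is the case D = [set: G], and a
   subgroup of G is a set D for which the predicate holds. *)
Record distributive_group (G : finType) (op : G -> G -> G) (D : {set G}) :
    Prop := DistributiveGroup {
  dg_nonempty : exists x, x \in D;
  dg_closed : {in D &, forall a b, op a b \in D};
  dg_ldiv : {in D &, forall a b, exists! x, x \in D /\ op a x = b};
  dg_rdiv : {in D &, forall a b, exists! y, y \in D /\ op y a = b};
  dg_distr_r : {in D & D & D, forall a b c,
    op (op a b) c = op (op a c) (op b c)};
  dg_distr_l : {in D & D & D, forall a b c,
    op c (op a b) = op (op c a) (op c b)}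
}.

Definition subgroup (G : finType) (op : G -> G -> G) (B : {set G}) : Prop :=
  distributive_group op B.

(* Subgroups of A are exactly the subgroups of G contained in A. *)
Definition simple (G : finType) (op : G -> G -> G) (A : {set G}) : Prop :=
  forall B : {set G}, B \proper A -> subgroup op B -> ~~ (1 < #|B|).

(* X.Y and X.p *)
Definition set_mul (G : finType) (op : G -> G -> G) (X Y : {set G}) : {set G} :=
  [set op x y | x in X, y in Y].

Definition rtranslate (G : finType) (op : G -> G -> G) (X : {set G}) (p : G) :
    {set G} :=
  [set op x p | x in X].

Definition distinguished (G : finType) (op : G -> G -> G) : Prop :=
  distributive_group op [set: G] /\
  forall (B : {set G}) (p : G), subgroup op B ->
    let L := set_mul op B (rtranslate op B p) in
    let R := set_mul op (rtranslate op B p) B in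
    [/\ subgroup op L, #|L| = #|B|, subgroup op R & #|R| = #|B|].

(* Main.v *)
Require Import Defs.
From mathcomp Require Import all_boot.

(** Call a quadruple (x, y, z, t) medial when (x.y).(z.t) = (x.z).(y.t).  If
    x, x' lie in A.p and y, y' in A.q and every such quadruple (x, y, x', y')
    is medial, then (x.y).(x'.y') = (x.x').(y.y') again lies in (A.p).(A.q),
    and a nonempty finite set closed under the operation is a subgroup.

    Mediality is propagated by one observation: distributivity makes the set
    of solutions in each single coordinate, the other three being fixed, closed
    under the operation (for y and t, [medial_op2] and [medial_op4]).  Simplicity of A makes
    two distinct solutions as good as all of A ([simple_closed_full]), so a
    few known quadruples suffice.  These are the degenerate ones, with x = z or
    y = t, and the quadruples (a.p, a.q, b.p, b.q), which are medial because
    both sides equal (a.b).(p.q). *)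

Section DistributiveGroup.

Context {G : finType} {op : G -> G -> G}.

Local Infix "·" := op (at level 40, left associativity).

Definition medial (x y z t : G) : bool :=
  (x · y) · (z · t) == (x · z) · (y · t).

Lemma op_distr_r : distributive_group op [set: G] ->
  forall a b c, (a · b) · c = (a · c) · (b · c).
Proof. by move=> dG a b c; apply: (dg_distr_r dG); rewrite inE. Qed.

Lemma op_distr_l : distributive_group op [set: G] ->
  forall a b c, c · (a · b) = (c · a) · (c · b).
Proof. by move=> dG a b c; apply: (dg_distr_l dG); rewrite inE. Qed.

Lemma op_injl : distributive_group op [set: G] -> forall a, injective (op a).
Proof.
move=> dG a x y eq_ax_ay.
have [z [_ uniq_z]] := dg_ldiv dG (in_setT a) (in_setT (a · y)).
by rewrite -(uniq_z x) // -(uniq_z y).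
Qed.

Lemma op_injr : distributive_group op [set: G] ->
  forall a, injective (fun x => x · a).
Proof.
move=> dG a x y eq_xa_ya.
have [z [_ uniq_z]] := dg_rdiv dG (in_setT a) (in_setT (y · a)).
by rewrite -(uniq_z x) // -(uniq_z y).
Qed.

(** The idempotent law: (a.a).a = (a.a).(a.a), then cancel a.a. *)
Lemma op_idem : distributive_group op [set: G] -> forall a, a · a = a.
Proof.
by move=> dG a; apply: (@op_injl dG (a · a)); rewrite -(op_distr_r dG).
Qed.

Lemma inj_stable_surj (S : {set G}) (f : G -> G) (y : G) :
  injective f -> {in S, forall x, f x \in S} -> y \in S ->
  exists2 x, x \in S & f x = y.
Proof.
move=> f_inj f_stable yS.
have imS : f @: S = S.
  apply/eqP; rewrite eqEcard (card_imset _ f_inj) leqnn andbT.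
  by apply/subsetP=> _ /imsetP[x xS ->]; apply: f_stable.
by move: yS; rewrite -{1}imS => /imsetP[x xS ->]; exists x.
Qed.

(** Finiteness turns closure into divisibility: an injective translation that
    maps S into itself permutes S. *)
Lemma closed_subgroup (S : {set G}) :
  distributive_group op [set: G] -> (exists x, x \in S) ->
  {in S &, forall a b, a · b \in S} -> subgroup op S.
Proof.
move=> dG neS closedS; split=> //.
- move=> a b aS bS.
  have [x xS axb] := inj_stable_surj S (op a) b (op_injl dG a)
    (fun x => closedS a x aS) bS.
  by exists x; split=> // y [_ ayb]; apply: (op_injl dG a); rewrite axb ayb.
- move=> a b aS bS.
  have [x xS xab] := inj_stable_surj S (fun x => x · a) b (op_injr dG a)
    (fun x xS => closedS x a xS aS) bS.
  by exists x; split=> // y [_ yab]; apply: (op_injr dG a); rewrite /= xab yab.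
- by move=> a b c _ _ _; apply: op_distr_r.
- by move=> a b c _ _ _; apply: op_distr_l.
Qed.

(** The set of solutions being closed, it is a subgroup of A with more than one
    element, hence all of A. *)
Lemma simple_closed_full (A : {set G}) (P : pred G) (a b : G) :
  distributive_group op [set: G] -> subgroup op A -> simple op A ->
  {in A &, forall x y, P x -> P y -> P (x · y)} ->
  a \in A -> b \in A -> a != b -> P a -> P b -> {in A, forall x, P x}.
Proof.
move=> dG sgA simpleA closedP aA bA neq_ab Pa Pb x xA.
pose S := [set y in A | P y].
have aS : a \in S by rewrite inE aA.
have bS : b \in S by rewrite inE bA.
have sgS : subgroup op S.
  apply: closed_subgroup => //; first by exists a.
  move=> y z; rewrite !inE => /andP[yA Py] /andP[zA Pz].
  by rewrite (dg_closed sgA) // closedP.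
have S_gt1 : 1 < #|S| by apply/card_gt1P; exists a, b.
have sSA : S \subset A by apply/subsetP=> y; rewrite inE => /andP[].
have : S == A.
  rewrite eqEproper sSA /=; apply/negP=> /simpleA /(_ sgS).
  by rewrite S_gt1.
by move/eqP=> eqSA; move: xA; rewrite -eqSA inE => /andP[].
Qed.

(** Both sides of the product of the two hypotheses collapse by
    distributivity, because the coordinates x, z, t are shared. *)
Lemma medial_op2 (x y y' z t : G) : distributive_group op [set: G] ->
  medial x y z t -> medial x y' z t -> medial x (y · y') z t.
Proof.
rewrite /medial => dG /eqP My /eqP My'; apply/eqP.
by rewrite (op_distr_l dG y y' x) (op_distr_r dG (x · y)) My My'
           -(op_distr_l dG) -(op_distr_r dG y).
Qed.

Lemma medial_op4 (x y z t t' : G) : distributive_group op [set: G] ->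
  medial x y z t -> medial x y z t' -> medial x y z (t · t').
Proof.
rewrite /medial => dG /eqP Mt /eqP Mt'; apply/eqP.
by rewrite (op_distr_l dG t t' z) (op_distr_l dG _ _ (x · y)) Mt Mt'
           -(op_distr_l dG) -(op_distr_l dG t).
Qed.

Lemma medial_eq13 (x y t : G) : distributive_group op [set: G] ->
  medial x y x t.
Proof. by move=> dG; rewrite /medial -(op_distr_l dG) (op_idem dG). Qed.

Lemma medial_eq24 (x y z : G) : distributive_group op [set: G] ->
  medial x y z y.
Proof. by move=> dG; rewrite /medial -(op_distr_r dG) (op_idem dG). Qed.

Lemma medial_translates (a b p q : G) : distributive_group op [set: G] ->
  medial (a · p) (a · q) (b · p) (b · q).
Proof.
move=> dG; apply/eqP; rewrite -(op_distr_l dG p q a) -(op_distr_l dG p q b).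
by rewrite -!(op_distr_r dG) -(op_distr_l dG).
Qed.

(** Starting from the degenerate quadruples and [medial_translates], the indices
    of the two translates by q are freed one at a time; each step needs two
    distinct known values of the index being freed. *)
Lemma medial_simple_translates (A : {set G}) (p q a b a' b' : G) :
  distributive_group op [set: G] -> subgroup op A -> simple op A ->
  a \in A -> b \in A -> a' \in A -> b' \in A ->
  medial (a · p) (b · q) (a' · p) (b' · q).
Proof.
move=> dG sgA simpleA aA bA a'A b'A.
have [<-|neq_aa'] := eqVneq a a'; first exact: medial_eq13.
have full2 d d' x z t : d \in A -> d' \in A -> d != d' ->
    medial x (d · q) z t -> medial x (d' · q) z t ->
    {in A, forall e, medial x (e · q) z t}.
  apply: (simple_closed_full _ (fun e => medial x (e · q) z t) d d') => //.
  by move=> e e' _ _ Me Me'; rewrite (op_distr_r dG); apply: medial_op2.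
have full4 d d' x y z : d \in A -> d' \in A -> d != d' ->
    medial x y z (d · q) -> medial x y z (d' · q) ->
    {in A, forall e, medial x y z (e · q)}.
  apply: (simple_closed_full _ (fun e => medial x y z (e · q)) d d') => //.
  by move=> e e' _ _ Me Me'; rewrite (op_distr_r dG); apply: medial_op4.
(* The second coordinate is free once the fourth is a'.q: the solutions a.q
   and a'.q come from [medial_translates] and [medial_eq24]. *)
have free2 : {in A, forall d,
    medial (a · p) (d · q) (a' · p) (a' · q)}.
  apply: (full2 a a') => //; first exact: medial_translates.
  exact: medial_eq24.
(* The fourth coordinate d'.q is then free too, from the two solutions a'.q
   and d.q; these are distinct only for d != a'. *)
have free4 d : d \in A -> d != a' -> {in A, forall d',
    medial (a · p) (d · q) (a' · p) (d' · q)}.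
  move=> dA neq_da'; apply: (full4 d a') => //; first exact: medial_eq24.
  exact: free2.
(* The excluded value is reached from a and a.a': by idempotence and
   cancellation, a, a' and a.a' are pairwise distinct. *)
have aa'A : a · a' \in A by apply: (dg_closed sgA).
have neq_aa'_a' : a · a' != a'.
  apply: contra neq_aa' => /eqP eq_a'; apply/eqP/(op_injr dG a').
  by rewrite /= eq_a' (op_idem dG).
have neq_a_aa' : a != a · a'.
  apply: contra neq_aa' => /eqP eq_a; apply/eqP/(op_injl dG a).
  by rewrite -eq_a (op_idem dG).
by apply: (full2 a (a · a')) => //; apply: free4.
Qed.

End DistributiveGroup.

Theorem theorem5p6 (G : finType) (op : G -> G -> G)
    (distinguishedG : distinguished op)
    (A : {set G}) (subgroupA : subgroup op A) (simpleA : simple op A)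
    (p q : G) :
  subgroup op (set_mul op (rtranslate op A p) (rtranslate op A q)).
Proof.
have [dG _] := distinguishedG.
apply: closed_subgroup => //.
  have [a aA] := dg_nonempty subgroupA.
  by exists (op (op a p) (op a q)); apply/imset2P;
     exists (op a p) (op a q); rewrite ?imset_f.
move=> u v /imset2P[_ _ /imsetP[a aA ->] /imsetP[b bA ->] ->].
move=> /imset2P[_ _ /imsetP[a' a'A ->] /imsetP[b' b'A ->] ->].
have /eqP-> := medial_simple_translates A p q a b a' b' dG subgroupA simpleA
  aA bA a'A b'A.
rewrite -!(op_distr_r dG); apply/imset2P.
by exists (op (op a a') p) (op (op b b') q) => //;
   apply: imset_f; apply: (dg_closed subgroupA).
Qed.
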